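(* Let $1\le s<\infty$, $1<r\le\infty$, and let $r'$ be the Hölder conjugate of $r$. Define $$\beta_c=\beta_c(s,r)=1+\frac{r'}{s}.$$ Then there exists a constant $C>0$ depending only on $s,r$ such that for every nonzero $\varphi\in C(\mathbb T,\mathbb R)$ with $\int_{\mathbb T}\varphi\,dx=0$ and $N_\varphi<\infty$, $$N_\varphi\,\|\varphi\|_{\dot W^{-1,s}(\mathbb T)}\;\ge\; C\,\frac{\|\varphi\|_{L^1(\mathbb T)}^{\beta_c}}{\|\varphi\|_{L^r(\mathbb T)}^{\beta_c-1}} .$$
   Context: $\mathbb T=\mathbb R/\mathbb Z$ is the one-dimensional torus with normalized Lebesgue measure (total mass $1$), and $C(\mathbb T,\mathbb R)$ denotes the continuous real-valued functions on $\mathbb T$. $N_\varphi$ denotes the number of times $\varphi$ changes sign on $\mathbb T$, i.e. the largest $m$ for which there are cyclically ordered distinct points $x_1,\dots,x_m\in\mathbb T$ with $\varphi(x_j)\varphi(x_{j+1})<0$ for $j=1,\dots,m$, where $x_{m+1}:=x_1$. For $1\le s<\infty$ with Hölder conjugate $s'\in(1,\infty]$, $$\|\varphi\|_{\dot W^{-1,s}(\mathbb T)}:=\sup\Big\{\Big|\int_{\mathbb T}\varphi u\,dx\Big| : u\in C^\infty(\mathbb T),\ \|u'\|_{L^{s'}(\mathbb T)}\le 1\Big\}.$$ *)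

(* Defs.v *)
From HB Require Import structures.
From mathcomp Require Import all_boot all_order all_algebra.
From mathcomp Require Import all_classical all_reals all_analysis.

Set Implicit Arguments.
Unset Strict Implicit.
Unset Printing Implicit Defensive.

Import Order.TTheory GRing.Theory Num.Theory.
Import numFieldNormedType.Exports.

Local Open Scope classical_set_scope.
Local Open Scope ring_scope.

(* Functions on the torus R/Z are represented by 1-periodic functions on R, and
   the normalized Lebesgue measure of R/Z by Lebesgue measure restricted to the
   fundamental domain [0, 1]. *)
Definition torus_measure (R : realType) : {measure set (measurableTypeR R) -> \bar R} :=
  mrestr (@lebesgue_measure R) (measurable_itv `[(0 : R), 1]).

Definition torus_continuous (R : realType) (phi : R -> R) : Prop :=
  periodic phi 1 /\ continuous phi.

Definition torus_smooth (R : realType) (u : R -> R) : Prop :=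
  periodic u 1 /\ forall (n : nat) (x : R), derivable (derive1n n u) x 1.

(* Cyclically ordered distinct points of R/Z are given by representatives with
   x_0 < x_1 < ... < x_(m-1) < x_0 + 1, and [ordS] is the cyclic successor. *)
Definition alternating_tuple (R : realType) (phi : R -> R) (m : nat) : Prop :=
  exists x : 'I_m -> R,
    (forall i j : 'I_m, (i < j)%N -> x i < x j < x i + 1) /\
    (forall j : 'I_m, phi (x j) * phi (x (ordS j)) < 0).

(* The supremum is +oo when there is no largest such m; otherwise it is attained
   ([alternating_tuple phi 0] always holds). *)
Definition sign_changes (R : realType) (phi : R -> R) : \bar R :=
  ereal_sup [set (m%:R)%:E | m in [set m : nat | alternating_tuple phi m]].

Definition torus_Lnorm (R : realType) (p : \bar R) (f : R -> R) : \bar R :=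
  ('N[torus_measure R]_p[EFin \o f])%E.

Definition negative_sobolev_norm (R : realType) (s : R) (phi : R -> R) :
    \bar R :=
  ereal_sup [set (`|\int[torus_measure R]_x (phi x * u x)|)%:E | u in
    [set u : R -> R | torus_smooth u /\
      (torus_Lnorm (hoelder_conjugate s%:E) (derive1 u) <= 1)%E]].

Definition beta_c (R : realType) (s : R) (r : \bar R) : R :=
  1 + fine (hoelder_conjugate r) / s.

(* Main.v *)
Require Import Defs.
From HB Require Import structures.
From mathcomp Require Import all_boot all_order all_algebra.
From mathcomp Require Import all_classical all_reals all_analysis.
From mathcomp Require Import measurable_realfun ess_sup_inf ring lra.

Set Implicit Arguments.
Unset Strict Implicit.
Unset Printing Implicit Defensive.

Import Order.TTheory GRing.Theory Num.Theory.
Import numFieldNormedType.Exports.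

Local Open Scope classical_set_scope.
Local Open Scope ring_scope.

(** Let [Psi] be a primitive of [phi]. It is periodic because [phi] has mean
    zero, and integration by parts turns the pairing of [phi] with a test
    function [u] into minus the pairing of [Psi] with [u']. The negative Sobolev
    norm is therefore at least the pairing of [Psi] with any mean-zero function
    whose L^(s')-norm is at most 1, and the point is to show that [Psi] is large
    on a large set. Write M and A for the L^1- and L^r-norms of [phi], and N for
    its number of sign changes.

    Where [phi] has constant sign, [Psi] is monotone, and the change of variables
    y = Psi x shows that the part of such an interval on which |Psi| <= t carries
    at most 2t of the mass of |phi|. All in all the set where |Psi| <= t carries a
    mass O(N t), so that for t a small multiple of M / N at least M / 2 of the
    mass lives where |Psi| > t. By the inequality of Hoelder the measure G of this
    set satisfies M / 2 <= A G^(1/r'). Testing [Psi] against its sign on this set,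
    divided by G^(1/s'), gives the lower bound t G / G^(1/s') = t G^(1/s), which
    is of order (M / N) (M / A)^(r'/s), as claimed.

    In the proof the sign of [Psi] on that set is replaced by the Lipschitz
    function [w x = deadzone (Psi x / t)], and the measure of the set by the
    integral of |w|; [exists_balanced_level] chooses the additive constant in
    [Psi] that makes the mean of [w] vanish. The mass estimate is
    [concentration_near_level]; it rests on [variation_alternations], which
    bounds a total variation by counting alternating points instead of cutting
    the circle into intervals.
    The duality is [negative_sobolev_norm_ge]. Test functions have to be smooth,
    so that [w] is first replaced there by a trigonometric polynomial, by means of
    [trig_poly_approximation]. The norms enter through [torus_hoelder] and
    [torus_Lnorm_normalized]. *)

(** * Calculus on the torus *)

Local Notation leb R :=
  (@lebesgue_measure R : {measure set (measurableTypeR R) -> \bar R}).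

Lemma torus_measure_outside (R : realType) :
  torus_measure R (~` `[(0 : R), 1]) = 0%E.
Proof.
rewrite /torus_measure /= /mrestr.
by rewrite [X in lebesgue_measure X](_ : _ = set0) ?measure0// -subset0 => x [].
Qed.

Lemma torus_integral_ge0E (R : realType) (f : R -> \bar R) :
  measurable_fun [set: R] f -> (forall x, 0 <= f x)%E ->
  (\int[torus_measure R]_x f x =
   \int[leb R]_(x in `[0%R : R, 1%R]) f x)%E.
Proof.
move=> mf f0.
rewrite (@ge0_negligible_integral _ _ _ (torus_measure R) setT
  (~` `[(0 : R), 1]))//;
  last 2 first.
- exact: measurableC.
- exact: torus_measure_outside.
rewrite classical_sets.setTD classical_sets.setCK.
apply: eq_measure_integral => A mA A01.
by rewrite /torus_measure /= /mrestr classical_sets.setIidl.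
Qed.

Lemma torus_measureT (R : realType) : torus_measure R setT = 1%E.
Proof.
by rewrite /torus_measure /= /mrestr classical_sets.setTI lebesgue_measure_itv/=
  lte01 sube0.
Qed.

Lemma continuous_measurable (R : realType) (f : R -> R) : continuous f ->
  measurable_fun [set: R] f.
Proof. exact: continuous_measurable_fun. Qed.

Lemma torus_integrable (R : realType) (f : R -> R) : continuous f ->
  (torus_measure R).-integrable setT (EFin \o f).
Proof.
move=> cf; apply/integrableP; split.
  by apply/measurable_EFinP; exact: continuous_measurable.
rewrite torus_integral_ge0E//; last first.
  apply: measurableT_comp => //; apply/measurable_EFinP.
  exact: continuous_measurable.
have : (leb R).-integrable `[(0 : R), 1] (EFin \o f).
  apply: continuous_compact_integrable; first exact: segment_compact.
  exact: continuous_subspaceT.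
by case/integrableP.
Qed.

Lemma is_derive_continuous (R : realType) (F f : R -> R) :
  (forall x : R, is_derive x (1 : R) F (f x)) -> continuous F.
Proof.
move=> dF x; apply: differentiable_continuous.
exact/derivable1_diffP/(@ex_derive _ _ _ _ _ _ _ (dF x)).
Qed.

Lemma torus_FTC (R : realType) (f F : R -> R) : continuous f ->
  (forall x : R, is_derive x (1 : R) F (f x)) ->
  \int[torus_measure R]_x f x = F 1 - F 0.
Proof.
move=> cf dF; have cF := is_derive_continuous dF.
rewrite /Rintegral (@negligible_integral _ _ _ (torus_measure R) setT
  (~` `[(0 : R), 1]))//;
  last 3 first.
- exact: measurableC.
- exact: torus_integrable.
- exact: torus_measure_outside.
rewrite classical_sets.setTD classical_sets.setCK
  (eq_measure_integral (leb R)); last first.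
  by move=> A mA A01; rewrite /torus_measure /= /mrestr classical_sets.setIidl.
rewrite (@continuous_FTC2 _ f F) ?ltr01//.
- exact: continuous_subspaceT.
- split => [x _||]; first exact: (@ex_derive _ _ _ _ _ _ _ (dF x)).
    exact/cvg_at_right_filter/cF.
  exact/cvg_at_left_filter/cF.
- by move=> x _; rewrite derive1E; apply: derive_val; exact: dF.
Qed.

Lemma derive_ge0_le (R : realType) (F f : R -> R) (a b : R) :
  (forall x : R, is_derive x (1 : R) F (f x)) -> a <= b ->
  (forall x, a < x < b -> 0 <= f x) -> F a <= F b.
Proof.
move=> dF ab f0; have [E|ltab] := eqVneq a b; first by rewrite E.
have {}ab : a < b by rewrite lt_neqAle ltab.
have [|c cab E] := @MVT _ F f a b ab (fun x _ => dF x).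
  exact/continuous_subspaceT/(is_derive_continuous dF).
by rewrite -subr_ge0 E mulr_ge0 ?subr_ge0 ?(ltW ab)// f0// -in_itv.
Qed.

Lemma derive_eq0_eq (R : realType) (F f : R -> R) (a b : R) :
  (forall x : R, is_derive x (1 : R) F (f x)) -> a <= b ->
  (forall x, a < x < b -> f x = 0) -> F a = F b.
Proof.
move=> dF ab f0; apply/eqP; rewrite eq_le (derive_ge0_le dF)//=; last first.
  by move=> x /f0 ->.
rewrite -lerN2; apply: (@derive_ge0_le _ (- F) (- f)) => // x /f0 /=.
by rewrite !fctE => ->; rewrite oppr0.
Qed.

(** The integral of [f] from a fixed [a] is differentiable only to the right of
    [a]. The left end point therefore moves with [x]; taking the difference with
    the value at 0 makes the result independent of its choice. *)
Lemma continuous_primitive (R : realType) (f : R -> R) : continuous f ->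
  exists2 F : R -> R, (forall x : R, is_derive x (1 : R) F (f x)) & F 0 = 0.
Proof.
move=> cf.
pose I (a x : R) := \int[leb R]_(t in `[a, x]) f t.
have intf a b : (leb R).-integrable `[a, b] (EFin \o f).
  apply: continuous_compact_integrable; first exact: segment_compact.
  exact: continuous_subspaceT.
have dI (a x : R) : a < x -> is_derive x (1 : R) (I a) (f x).
  move=> ax; have xx : x < x + 1 by rewrite ltrDl.
  have [d1 d2] := @continuous_FTC1_closed _ f a x (x + 1) xx (intf _ _) ax (cf x).
  by apply: DeriveDef => //; rewrite -derive1E.
have II (a b x y : R) : a < x -> b < x -> x <= y -> I a y - I b y = I a x - I b x.
  move=> ax bx xy.
  have dII (z : R) : a < z -> b < z -> is_derive z (1 : R) (I a \- I b) 0.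
    by move=> az bz; rewrite -(subrr (f z)); apply: is_deriveB; exact: dI.
  move: xy; rewrite le_eqVlt => /predU1P[->//|xy].
  have [z| |c _] := @MVT _ (I a \- I b) (cst 0) x y xy.
  - by rewrite in_itv/= => /andP[xz _]; apply: dII; exact: lt_trans xz.
  - apply: derivable_within_continuous => z; rewrite in_itv/= => /andP[xz _].
    have [d _] := dII z (lt_le_trans ax xz) (lt_le_trans bx xz); exact: d.
  - by rewrite mul0r => /eqP; rewrite subr_eq0 => /eqP.
have IIE (a b x y : R) : a < x -> b < x -> a < y -> b < y ->
    I a y - I b y = I a x - I b x.
  move=> ax bx ay by_; have [xy|/ltW yx] := leP x y; first exact: II.
  by rewrite (II a b y x).
pose F x := I (- (`|x| + 1)) x - I (- (`|x| + 1)) 0.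
exists F => [x|]; last by rewrite /F subrr.
pose a := - (`|x| + 2).
have a0 : a < 0 by rewrite oppr_lt0 ltr_wpDl.
have ax : a < x.
  by rewrite /a; have := ler_norm (- x); rewrite normrN; lra.
have d : is_derive x (1 : R) (fun z => I a z - I a 0) (f x).
  rewrite -(subr0 (f x)).
  by apply: (@is_deriveB _ _ _ (I a) (cst (I a 0))); exact: dI.
apply: near_eq_is_derive d => //; near=> z.
rewrite /F -[LHS](subrK (I a z)) -[RHS](subrK (I a 0)).
have /= zx : `|x - z| < 1 by near: z; apply: cvgr_dist_lt.
have zb : - (`|z| + 1) < z.
  by have := ler_norm (- z); rewrite normrN; lra.
have az : a < z.
  by rewrite /a; have := ler_norm (- x); rewrite normrN; move: zx; rewrite ltr_norml; lra.
have b0 : - (`|z| + 1) < 0 by rewrite oppr_lt0 ltr_wpDl.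
have := @IIE (- (`|z| + 1)) a 0 z b0 a0 zb az.
by lra.
Unshelve. all: end_near. Qed.

Section TorusIntegral.
Variable R : realType.
Implicit Types f g : R -> R.

Lemma continuous_add f g : continuous f -> continuous g ->
  continuous (fun x => f x + g x).
Proof. by move=> cf cg x; apply: cvgD; [exact: cf|exact: cg]. Qed.

Lemma continuous_sub f g : continuous f -> continuous g ->
  continuous (fun x => f x - g x).
Proof. by move=> cf cg x; apply: cvgB; [exact: cf|exact: cg]. Qed.

Lemma continuous_mul f g : continuous f -> continuous g ->
  continuous (fun x => f x * g x).
Proof. by move=> cf cg x; apply: cvgM; [exact: cf|exact: cg]. Qed.

Lemma continuous_norm f : continuous f -> continuous (fun x => `|f x|).
Proof. by move=> cf x; apply: cvg_norm; exact: cf. Qed.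

Lemma continuous_const (c : R) : continuous (fun _ : R => c).
Proof. by move=> x; exact: cvg_cst. Qed.

Lemma torus_integralD f g : continuous f -> continuous g ->
  \int[torus_measure R]_x (f x + g x) =
  \int[torus_measure R]_x f x + \int[torus_measure R]_x g x.
Proof. by move=> cf cg; rewrite RintegralD//; exact: torus_integrable. Qed.

Lemma torus_integralB f g : continuous f -> continuous g ->
  \int[torus_measure R]_x (f x - g x) =
  \int[torus_measure R]_x f x - \int[torus_measure R]_x g x.
Proof. by move=> cf cg; rewrite RintegralB//; exact: torus_integrable. Qed.

Lemma torus_integralZ (k : R) f : continuous f ->
  \int[torus_measure R]_x (k * f x) = k * \int[torus_measure R]_x f x.
Proof. by move=> cf; rewrite RintegralZl//; exact: torus_integrable. Qed.

Lemma torus_integral_cst (k : R) : \int[torus_measure R]_x k = k.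
Proof. by rewrite Rintegral_cst// torus_measureT mulr1. Qed.

Lemma torus_integral_le f g : continuous f -> continuous g ->
  (forall x, f x <= g x) ->
  \int[torus_measure R]_x f x <= \int[torus_measure R]_x g x.
Proof.
by move=> cf cg fg; apply: le_Rintegral => [//|||x _];
  [exact: torus_integrable|exact: torus_integrable|exact: fg].
Qed.

Lemma torus_integral_ge0 f : (forall x, 0 <= f x) ->
  0 <= \int[torus_measure R]_x f x.
Proof. by move=> f0; apply: Rintegral_ge0 => x _; exact: f0. Qed.

Lemma torus_integral_abs f : continuous f ->
  `|\int[torus_measure R]_x f x| <= \int[torus_measure R]_x `|f x|.
Proof. by move=> cf; apply: le_normr_Rintegral => //; exact: torus_integrable. Qed.

Lemma eq_torus_integral f g : f =1 g ->
  \int[torus_measure R]_x f x = \int[torus_measure R]_x g x.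
Proof. by move=> fg; apply: eq_Rintegral => x _; exact: fg. Qed.

Lemma periodic_int f (x : R) (m : int) : periodic f 1 -> f (x + m%:~R) = f x.
Proof.
move=> fT; case: m => n; first by rewrite -pmulrn (periodicn fT).
by rewrite NegzE mulrNz -pmulrn -[LHS](periodicn fT n.+1) subrK.
Qed.

End TorusIntegral.

(** * Total variation and alternating points *)

Definition alternates (R : realType) (phi : R -> R) : rel R :=
  fun x y => (x < y) && (phi x * phi y < 0).

(** The total variation of a monotone function is its net variation: [V - F] is
    constant where [phi] is nonnegative and [V + F] where it is nonpositive. *)
Lemma variation_one_sign (R : realType) (phi w F V : R -> R) (kappa a b : R) :
  (forall x : R, is_derive x (1 : R) F (phi x * w x)) ->
  (forall x : R, is_derive x (1 : R) V (`|phi x| * w x)) ->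
  (forall x y, F x - F y <= kappa) -> a <= b ->
  (forall x, a < x < b -> 0 <= phi x) \/ (forall x, a < x < b -> phi x <= 0) ->
  V b - V a <= kappa.
Proof.
move=> dF dV Fk ab [phi0|phi0].
- have E : (V - F) a = (V - F) b.
    apply: (@derive_eq0_eq _ _ (fun x => `|phi x| * w x - phi x * w x)) => // x xab.
    by rewrite ger0_norm ?phi0// subrr.
  by apply: le_trans (Fk b a); move: E; rewrite !fctE; lra.
- have E : (V + F) a = (V + F) b.
    apply: (@derive_eq0_eq _ _ (fun x => `|phi x| * w x + phi x * w x)) => // x xab.
    by rewrite ler0_norm ?phi0// mulNr addNr.
  by apply: le_trans (Fk a b); move: E; rewrite !fctE; lra.
Qed.

(** The increment of [V] is the total variation of [F], and each block on which
    [phi] keeps a constant sign contributes at most [kappa] to it. Blocks are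
    removed from the left: if [c] is the supremum of the right ends of the blocks
    starting at [a], then ]a, y[ contains values of both signs as soon as
    [c < y], so that a chain in ]c, b[ can be extended by one more point on its
    left. Zeros of [phi] are excluded from chains because a single zero would
    otherwise count as a chain of length 1. *)
Lemma variation_alternations (R : realType) (phi w F V : R -> R) (kappa : R)
    (n : nat) (a b : R) :
  (forall x : R, is_derive x (1 : R) F (phi x * w x)) ->
  (forall x : R, is_derive x (1 : R) V (`|phi x| * w x)) ->
  (forall x y, F x - F y <= kappa) -> a <= b ->
  (forall s, sorted (alternates phi) s ->
     {in s, forall x, (a < x < b) && (phi x != 0)} -> (size s <= n)%N) ->
  V b - V a <= n%:R * kappa.
Proof.
move=> dF dV Fk; elim: n a => [|n IH] a ab chain.
  have phi0 x : a < x < b -> phi x = 0.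
    move=> xab; apply/eqP/negPn/negP => px.
    suff : (size [:: x] <= 0)%N by [].
    by apply: chain => // y; rewrite inE => /eqP ->; rewrite xab.
  rewrite mul0r subr_le0 (@derive_eq0_eq _ V _ a b dV ab)// => x /phi0 ->.
  by rewrite normr0 mul0r.
pose S := [set z | a <= z <= b /\
  ((forall x, a < x < z -> 0 <= phi x) \/ (forall x, a < x < z -> phi x <= 0))].
have Sa : S a.
  split; first by rewrite lexx.
  by left => x /andP[/lt_trans/[apply]]; rewrite ltxx.
have Sb : ubound S b by move=> z [/andP[_]].
have supS : has_sup S by split; [exists a|exists b].
pose c := sup S.
have ac : a <= c by apply: ub_le_sup => //; exists b.
have cb : c <= b by apply: ge_sup => //; exists a.
have signc : (forall x, a < x < c -> 0 <= phi x) \/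
             (forall x, a < x < c -> phi x <= 0).
  have [H|/existsNP[x /not_implyP[/andP[ax xc] /negP]]] :=
    pselect (forall x, a < x < c -> 0 <= phi x); first by left.
  (* a negative value rules out the first alternative on every longer block *)
  rewrite -ltNge => px; right => y /andP[ay yc].
  have mc : Num.max x y < c by rewrite gt_max xc.
  have [z [_ Sz] /=] := sup_gt (ex_intro _ a Sa) mc.
  rewrite gt_max => /andP[xz yz].
  case: Sz => [/(_ x)|]; last by apply; rewrite ay.
  by rewrite ax xz => /(_ isT); rewrite leNgt px.
have -> : V b - V a = (V c - V a) + (V b - V c) by ring.
rewrite -natr1 mulrDl mul1r addrC; apply: lerD.
  apply: IH => // s ss sin.
  case: s => [//|y s] in ss sin *.
  have /andP[/andP[cy yb] y0] : (c < y < b) && (phi y != 0).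
    by apply: sin; rewrite inE eqxx.
  have ay : a < y by exact: le_lt_trans cy.
  have /not_andP[|/not_orP[n1 n2]] : ~ S y.
  - by move=> Sy; move: cy; rewrite ltNge ub_le_sup//; exists b.
  - by rewrite (ltW ay) (ltW yb).
  have [x /andP[ax xy] px] : exists2 x, a < x < y & phi x * phi y < 0.
    have [yneg|ypos|E] := ltgtP (phi y) 0; last by rewrite E eqxx in y0.
    - have /existsNP[x /not_implyP[axy /negP]] := n2.
      by rewrite -ltNge => px; exists x => //; rewrite pmulr_rlt0.
    - have /existsNP[x /not_implyP[axy /negP]] := n1.
      by rewrite -ltNge => px; exists x => //; rewrite nmulr_rlt0.
  have := chain (x :: y :: s); apply.
  - by rewrite /= {1}/alternates xy px.
  - move=> z; rewrite inE => /predU1P[->|zs].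
      rewrite ax (lt_trans xy yb) /=.
      by apply: contraTneq px => ->; rewrite mul0r ltxx.
    by have /andP[/andP[cz ->] ->] := sin _ zs; rewrite (le_lt_trans ac cz).
exact: variation_one_sign signc.
Qed.

(** The signs along a chain alternate, so that the last and the first values
    have opposite signs when the number of points is even: the chain closes up
    around the circle. *)
Lemma alternating_tuple_chain (R : realType) (phi : R -> R) (s : seq R) :
  sorted (alternates phi) s -> {in s &, forall x y, y < x + 1} ->
  ~~ odd (size s) -> alternating_tuple phi (size s).
Proof.
move=> ss sin evens; exists (fun i => nth 0 s i); split => [i j ij|].
  apply/andP; split; last by apply: sin; exact: mem_nth.
  have := @sorted_ltn_nth _ <%R lt_trans 0 s; apply; rewrite ?inE//.
  by apply: sub_sorted ss => x y /andP[].
have step i : (i.+1 < size s)%N -> phi (nth 0 s i) * phi (nth 0 s i.+1) < 0.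
  move=> i1; have /(sortedP 0)/(_ i i1)/andP[] := ss; by [].
move=> j; have [j1|] := ltnP j.+1 (size s).
  by rewrite /= modn_small//; exact: step.
rewrite leq_eqVlt ltnNge ltn_ord orbF => /eqP js.
rewrite /= -js modnn.
have sgn i : (i.+1 < size s)%N ->
    (-1) ^+ i.+1 * (phi (nth 0 s i.+1) * phi (nth 0 s 0)) > 0.
  elim: i => [|i IH] i1.
    by rewrite expr1 mulN1r oppr_gt0 mulrC; exact: step.
  have := IH (ltn_trans (ltnSn _) i1); have := step _ i1.
  rewrite [(-1) ^+ i.+2]exprS.
  set x := phi (nth 0 s i.+1); set y := phi (nth 0 s i.+2).
  set z := phi _; set e := (-1) ^+ _ => xy exz.
  have e2 : e * e = 1 by rewrite -expr2 sqrr_sign.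
  have : 0 < (e * (x * z)) * - (x * y) by rewrite mulr_gt0// oppr_gt0.
  have -> : e * (x * z) * - (x * y) = -1 * e * (y * z) * x ^+ 2 by ring.
  rewrite pmulr_lgt0// exprn_even_gt0//=.
  by apply: contraTneq xy => ->; rewrite mul0r ltxx.
have [k Ek] : exists k, nat_of_ord j = k.+1.
  case: (nat_of_ord j) js => [E|k _]; last by exists k.
  by rewrite E in evens.
have := sgn k; rewrite -Ek => /(_ (ltn_ord j)).
rewrite -signr_odd.
have -> : odd j.
  by move: evens; have /= -> := congr1 odd js; rewrite negbK.
by rewrite expr1 mulN1r oppr_gt0.
Qed.

(** The summand 1 pays for the last point of a chain of odd length, which has
    to be dropped before the chain closes up. *)
Lemma chain_size_le (R : realType) (phi : R -> R) (a : R) (s : seq R) :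
  sorted (alternates phi) s -> {in s, forall x, a < x < a + 1} ->
  ((size s)%:R%:E <= sign_changes phi + 1)%E.
Proof.
move=> ss sin.
pose s' := take (size s - odd (size s)) s.
have zs : size s' = (size s - odd (size s))%N by rewrite size_takel// leq_subr.
have sN : ((size s')%:R%:E <= sign_changes phi)%E.
  apply: ereal_sup_ubound; exists (size s') => //.
  apply: alternating_tuple_chain; first exact: take_sorted.
    move=> x y xs ys.
    have /andP[ax _] := sin _ (mem_take xs).
    have /andP[_ ya] := sin _ (mem_take ys).
    by rewrite (lt_trans ya)// ltrD2r.
  by rewrite zs oddB ?leq_b1 ?oddb ?addbb//; case: (size s) => // m; case: odd.
apply: (le_trans _ (leeD2r 1%E sN)).
rewrite -EFinD lee_fin natr1 ler_nat zs.
by case: odd; rewrite ?subn0 ?leqnSn// subn1 leqSpred.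
Qed.

(** Two points of [0, 1] at distance 1 represent the same point of the torus,
    where [phi] cannot take opposite signs. *)
Lemma sign_changes_ge2 (R : realType) (phi : R -> R) (x y : R) :
  periodic phi 1 -> 0 <= x <= 1 -> 0 <= y <= 1 -> phi x * phi y < 0 ->
  (2%:E <= sign_changes phi)%E.
Proof.
move=> per; wlog xy : x y / x <= y.
  move=> H x01 y01 pxy; have [/H|/ltW/H] := leP x y; first exact.
  by apply => //; rewrite mulrC.
move=> /andP[x0 x1] /andP[y0 y1] pxy.
have nxy : phi x != phi y.
  by apply: contraTneq pxy => ->; rewrite -leNgt -expr2 sqr_ge0.
have {}xy : x < y by rewrite lt_neqAle xy andbT; apply: contraNneq nxy => ->.
have yx : y < x + 1.
  have : y <= x + 1 by rewrite (le_trans y1)// lerDr.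
  rewrite le_eqVlt => /predU1P[E|//].
  by rewrite E per eqxx in nxy.
apply: ereal_sup_ubound; exists 2%N => //.
apply: (@alternating_tuple_chain _ _ [:: x; y]) => //.
  by rewrite /= /alternates xy pxy.
move=> u v; rewrite !inE => /orP[]/eqP-> /orP[]/eqP-> //; rewrite ?ltrDl//.
by rewrite (lt_trans xy)// ltrDl.
Qed.

(** * Uniform approximation by trigonometric polynomials *)

Section TrigonometricApproximation.
Variable R : realType.
Implicit Types (f g p : R -> R).

(** The trigonometric polynomials, presented as the algebra generated by the
    first two harmonics: stability under products and derivatives is then a
    plain induction, without product-to-sum formulas. *)
Inductive trig_poly : (R -> R) -> Prop :=
| trig_cst c : trig_poly (fun _ => c)
| trig_cos : trig_poly (fun x => cos (2 * pi * x))
| trig_sin : trig_poly (fun x => sin (2 * pi * x))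
| trig_add f g : trig_poly f -> trig_poly g -> trig_poly (fun x => f x + g x)
| trig_mul f g : trig_poly f -> trig_poly g -> trig_poly (fun x => f x * g x).

Lemma is_derive_cos2pi (x : R) :
  is_derive x (1 : R) (fun z : R => cos (2 * pi * z))
    (- (2 * pi) * sin (2 * pi * x)).
Proof.
have d : is_derive x (1 : R) (fun z : R => 2 * pi * z) (2 * pi).
  rewrite -[X in is_derive _ _ _ X]mulr1.
  exact: (@is_deriveZ _ _ _ id (2 * pi) x 1 1).
have := @is_derive1_comp _ cos _ x _ _ (is_derive_cos _) d.
by move/is_derive_eq; apply; rewrite mulrC mulNr mulrN.
Qed.

Lemma is_derive_sin2pi (x : R) :
  is_derive x (1 : R) (fun z : R => sin (2 * pi * z)) (2 * pi * cos (2 * pi * x)).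
Proof.
have d : is_derive x (1 : R) (fun z : R => 2 * pi * z) (2 * pi).
  rewrite -[X in is_derive _ _ _ X]mulr1.
  exact: (@is_deriveZ _ _ _ id (2 * pi) x 1 1).
have := @is_derive1_comp _ sin _ x _ _ (is_derive_sin _) d.
by move/is_derive_eq; apply; rewrite mulrC.
Qed.

Lemma trig_poly_derive p : trig_poly p ->
  exists2 dp, trig_poly dp & forall x : R, is_derive x (1 : R) p (dp x).
Proof.
elim=> {p} [c| | |f g _ [df tdf Df] _ [dg tdg Dg]|f g tf [df tdf Df] tg [dg tdg Dg]].
- exists (fun _ => 0); first exact: trig_cst.
  by move=> x; exact: is_derive_cst.
- exists (fun x => - (2 * pi) * sin (2 * pi * x)); last exact: is_derive_cos2pi.
  exact: trig_mul (trig_cst _) trig_sin.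
- exists (fun x => 2 * pi * cos (2 * pi * x)); last exact: is_derive_sin2pi.
  exact: trig_mul (trig_cst _) trig_cos.
- exists (fun x => df x + dg x); first exact: trig_add.
  by move=> x; exact: is_deriveD.
- exists (fun x => f x * dg x + g x * df x).
    by apply: trig_add; exact: trig_mul.
  by move=> x; exact: is_deriveM.
Qed.

Lemma trig_poly_periodic p : trig_poly p -> periodic p 1.
Proof.
elim=> {p} [//| | |f g _ If _ Ig x|f g _ If _ Ig x]; rewrite ?If ?Ig//.
- by move=> x; rewrite mulrDr mulr1 [2 * pi]mulrC mulr_natr cosD2pi.
- by move=> x; rewrite mulrDr mulr1 [2 * pi]mulrC mulr_natr sinD2pi.
Qed.

Lemma trig_poly_continuous p : trig_poly p -> continuous p.
Proof. by case/trig_poly_derive => dp _ /is_derive_continuous. Qed.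

Lemma trig_poly_derive1n p n : trig_poly p -> trig_poly (derive1n n p).
Proof.
move=> tp; elim: n => [//|n]; rewrite derive1nS.
move=> /trig_poly_derive[dp tdp Dp]; rewrite (_ : derive1 _ = dp)//.
by apply/funext => x; rewrite derive1E; apply: derive_val; exact: Dp.
Qed.

(** This is cos^2 (pi z), whose normalized powers form an approximate identity
    on the torus. *)
Definition bump (z : R) : R := (1 + cos (2 * pi * z)) / 2.

Lemma bump_ge0 z : 0 <= bump z.
Proof. by rewrite divr_ge0// -lerBlDl sub0r cos_geN1. Qed.

Lemma bump_le1 z : bump z <= 1.
Proof. by rewrite ler_pdivrMr// mul1r (natrD _ 1 1) lerD2l cos_le1. Qed.

Lemma bump_trig : trig_poly bump.
Proof.
exact: trig_mul (trig_add (trig_cst _) trig_cos) (trig_cst _).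
Qed.

Lemma bumpX_trig n : trig_poly (fun z => bump z ^+ n).
Proof.
elim: n => [|n IH]; first by under eq_fun do rewrite expr0; exact: trig_cst.
by under eq_fun do rewrite exprS; apply: trig_mul => //; exact: bump_trig.
Qed.

Lemma bumpX_continuous n (x : R) : continuous (fun y => bump (x - y) ^+ n).
Proof.
move=> y; apply: (@continuous_comp _ _ _ (fun y : R => x - y) (fun z => bump z ^+ n)).
  by apply: cvgB; [exact: cvg_cst|exact: cvg_id].
exact: trig_poly_continuous (bumpX_trig n) _.
Qed.

(** By the addition formula one factor of the kernel is a sum of products of a
    function of [x] by a function of [y]. The functions of [y] are absorbed into
    [f], which is why the induction runs over all continuous [f]. *)
Lemma bump_convolution_trig n f : continuous f ->
  trig_poly (fun x => \int[torus_measure R]_y (f y * bump (x - y) ^+ n)).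
Proof.
pose c (x : R) := cos (2 * pi * x); pose s (x : R) := sin (2 * pi * x).
have cc : continuous c by exact: trig_poly_continuous trig_cos.
have cs : continuous s by exact: trig_poly_continuous trig_sin.
elim: n f => [|n IH] f cf.
  have -> : (fun x => \int[torus_measure R]_y (f y * bump (x - y) ^+ 0)) =
            (fun=> \int[torus_measure R]_y f y).
    apply/funext => x; apply: eq_torus_integral => y.
    by rewrite expr0 mulr1.
  exact: trig_cst.
pose J f x := \int[torus_measure R]_y (f y * bump (x - y) ^+ n).
have cJ g x : continuous g -> continuous (fun y => g y * bump (x - y) ^+ n).
  by move=> cg; apply: continuous_mul => //; exact: bumpX_continuous.
rewrite (_ : (fun x => _) = (fun x => 2^-1 * (J f x + (c x *
  J (fun y => f y * c y) x + s x * J (fun y => f y * s y) x)))); last first.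
  have cfc := continuous_mul cf cc; have cfs := continuous_mul cf cs.
  apply/funext => x; rewrite /J.
  rewrite -!torus_integralZ; try exact: cJ.
  rewrite -!torus_integralD; try by repeat (apply: continuous_add ||
    apply: cJ || apply: continuous_mul || exact: continuous_const).
  rewrite -torus_integralZ; last first.
    by repeat (apply: continuous_add ||
    apply: cJ || apply: continuous_mul || exact: continuous_const).
  apply: eq_torus_integral => y.
  rewrite exprSr; set b := bump _ ^+ n.
  rewrite /bump mulrBr cosB -/(c x) -/(c y) -/(s x) -/(s y).
  by field.
apply: trig_mul (trig_cst _) _; apply: trig_add; first exact: IH.
apply: trig_add; apply: trig_mul; first exact: trig_cos.
- by apply: IH; exact: continuous_mul.
- exact: trig_sin.
- by apply: IH; exact: continuous_mul.
Qed.

Definition bump_mass n (x : R) := \int[torus_measure R]_y (bump (x - y) ^+ n).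

Lemma is_derive_bump (z : R) :
  is_derive z (1 : R) bump (- pi * sin (2 * pi * z)).
Proof.
have := is_deriveZ 2^-1 (is_deriveD (is_derive_cst (1 : R) z (1 : R)) (is_derive_cos2pi z)).
rewrite (_ : _ \*: _ = bump); last first.
  by apply/funext => y; rewrite /bump !fctE [RHS]mulrC.
by move/is_derive_eq; apply; rewrite /GRing.scale/=; field.
Qed.

(** Wallis recursion: it says that the derivative of
    sin (2 pi z) cos^(2 n) (pi z) has mean zero over a period. *)
Lemma bump_massS n x :
  (2 * n.+1)%:R * bump_mass n.+1 x = (2 * n).+1%:R * bump_mass n x.
Proof.
pose H := fun z : R => sin (2 * pi * z) * bump z ^+ n.
pose h := fun z : R => 2 * pi * ((2 * n.+1)%:R * bump z ^+ n.+1 -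
   (2 * n).+1%:R * bump z ^+ n).
have dH z : is_derive z (1 : R) H (h z).
  have := is_deriveM (is_derive_sin2pi z) (is_deriveX n (is_derive_bump z)).
  rewrite (_ : _ * _ = H); last by apply/funext => y; rewrite /H !fctE.
  move/is_derive_eq; apply; rewrite /GRing.scale/= /h !fctE.
  set s := sin _; set c := cos _.
  have E : s * s = 4 * bump z * (1 - bump z).
    have := cos2Dsin2 (2 * pi * z); rewrite -/s -/c !expr2 /bump -/c => H1.
    by rewrite (_ : s * s = 1 - c * c); [field|rewrite -H1; ring].
  have Ec : c = 2 * bump z - 1 by rewrite /bump -/c; field.
  rewrite Ec; case: (n) => [|m] /=.
    by rewrite !expr0 expr1 !mul0r mulr0; ring.
  rewrite (_ : s * (m.+1%:R * bump z ^+ m * (- pi * s)) =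
     - pi * m.+1%:R * bump z ^+ m * (s * s)); last by ring.
  by rewrite E !exprS; ring.
have dG (y : R) : is_derive y (1 : R) (fun y => - H (x - y)) (h (x - y)).
  have d : is_derive y (1 : R) (fun y : R => x - y) (-1).
    have := is_deriveB (is_derive_cst x y (1 : R)) (is_derive_id y (1 : R)).
    by move/is_derive_eq; apply; rewrite sub0r.
  have := is_deriveN (@is_derive1_comp _ H (fun y : R => x - y) y _ _ (dH (x - y)) d).
  by move/is_derive_eq; apply; rewrite mulrN1 opprK.
have cb m := @bumpX_continuous m x.
have ch : continuous (fun y => h (x - y)).
  by repeat (apply: cb || apply: continuous_mul ||
    apply: continuous_sub || apply: continuous_const).
have := torus_FTC ch dG.
rewrite /h torus_integralZ; last first.
  by repeat (apply: cb || apply: continuous_mul ||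
    apply: continuous_sub || apply: continuous_const).
rewrite torus_integralB; try by apply: continuous_mul => //; exact: continuous_const.
rewrite !torus_integralZ// -/(bump_mass n.+1 x) -/(bump_mass n x).
have per : periodic H 1.
  apply: trig_poly_periodic; rewrite /H.
  by apply: trig_mul; [exact: trig_sin|exact: bumpX_trig].
have -> : - H (x - 1) - - H (x - 0) = 0.
  by rewrite subr0 opprK -[X in _ + H X](subrK 1 x) per addNr.
move=> /eqP.
have pi0 : 2 * pi != 0 :> R by rewrite gt_eqF// mulr_gt0// pi_gt0.
rewrite mulf_eq0 (negbTE pi0) /= subr_eq0 => /eqP; exact.
Qed.

Lemma bump_mass_gt0 n x : 0 < bump_mass n x.
Proof.
elim: n => [|n IH].
  rewrite /bump_mass (eq_torus_integral (g := fun=> 1)) => [|y]; last exact: expr0.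
  by rewrite torus_integral_cst.
have := bump_massS n x => E.
by rewrite -(@pmulr_rgt0 _ (2 * n.+1)%:R)// E mulr_gt0.
Qed.

(** The recursion for the masses does not involve [x]; this spares the
    invariance of the integral under translations. *)
Lemma bump_mass_cst n x : bump_mass n x = bump_mass n 0.
Proof.
elim: n => [|n IH]; first by apply: eq_torus_integral => y; rewrite !expr0.
apply: (@mulfI _ (2 * n.+1)%:R); first by rewrite pnatr_eq0 muln_eq0.
by rewrite !bump_massS IH.
Qed.

Lemma bump_lt1 (z : R) : 0 < z <= 2^-1 -> bump z < 1.
Proof.
move=> /andP[z0 z1]; rewrite ltr_pdivrMr// mul1r (natrD _ 1 1) ltrD2l.
have p0 : 0 < pi :> R := pi_gt0 R.
rewrite -[ltRHS]cos0 ltr_cos ?in_itv/= ?lexx ?pi_ge0//.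
  by rewrite mulr_gt0// mulr_gt0.
rewrite !mulr_ge0 ?(ltW p0) ?(ltW z0)//=.
by rewrite mulrAC ler_piMl// ?(ltW p0)//; lra.
Qed.

Lemma bump_le (z w : R) : 0 <= z <= `|w| -> `|w| <= 2^-1 -> bump w <= bump z.
Proof.
move=> /andP[z0 zw] w1; have p0 : 0 < pi :> R := pi_gt0 R.
have -> : bump w = bump `|w|.
  rewrite /bump; have [//|w0] := ger0P w.
  by rewrite mulrN cosN.
rewrite ler_pdivrMr// divfK// lerD2l leNgt ltr_cos.
- by rewrite -leNgt ler_pM2l// mulr_gt0.
- rewrite in_itv/= !mulr_ge0 ?(ltW p0)//= mulrAC ler_piMl// ?(ltW p0)//; lra.
- rewrite in_itv/= !mulr_ge0 ?(ltW p0)//= mulrAC ler_piMl// ?(ltW p0)//; lra.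
Qed.

(** The quantity [1 - bump (x - y)] vanishes only if [x] and [y] agree modulo 1,
    so that a large multiple of it dominates the variation of [g] except near the
    diagonal, where this variation is below [eps]. *)
Lemma lipschitz_bump_modulus g (L eps : R) : periodic g 1 ->
  (forall x y, `|g x - g y| <= L * `|x - y|) -> 0 < eps ->
  exists2 K, 0 <= K &
    forall x y, `|g x - g y| <= eps + K * (1 - bump (x - y)).
Proof.
move=> per gL e0.
have L0 : 0 <= L.
  by have := gL 1 0; rewrite subr0 normr1 mulr1; apply: le_trans.
pose d := Num.min (eps / (L + 1)) 2^-1.
have d0 : 0 < d by rewrite lt_min divr_gt0//= ?invr_gt0// ltr_wpDl.
have d1 : bump d < 1 by rewrite bump_lt1// d0 ge_min lexx orbT.
have K0 : 0 <= L / (1 - bump d) by rewrite divr_ge0// subr_ge0 ltW.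
exists (L / (1 - bump d)) => // x y.
wlog xy : x / `|x - y| <= 2^-1.
  (* translate x by an integer to bring x - y into [-1/2, 1/2] *)
  pose m := - Num.floor (x - y + 2^-1).
  move=> /(_ (x + m%:~R)); rewrite (periodic_int _ _ per) addrAC.
  rewrite (periodic_int _ _ (trig_poly_periodic bump_trig)); apply.
  have /andP[] := floor_itv (x - y + 2^-1).
  by rewrite /m mulrNz intrD ler_norml; lra.
have [xd|dx] := leP `|x - y| d.
  apply: le_trans (gL x y) _.
  rewrite (@le_trans _ _ eps)//; last first.
    by rewrite lerDl mulr_ge0// subr_ge0 bump_le1.
  apply: (@le_trans _ _ ((L + 1) * d)); first by rewrite ler_pM// lerDl.
  rewrite mulrC -ler_pdivlMr ?ltr_wpDl//.
  by rewrite /d ge_min lexx.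
apply: le_trans (gL x y) _; rewrite (@le_trans _ _ L)//.
  by rewrite ler_piMr// (le_trans xy)// invf_le1// ler1n.
rewrite -[leLHS]add0r lerD ?(ltW e0)//.
rewrite mulrAC ler_pdivlMr ?subr_gt0// ler_wpM2l// lerD2l lerN2.
by apply: bump_le => //; rewrite (ltW d0) ltW.
Qed.

(** The argument of Korovkin: averaging the bound of [lipschitz_bump_modulus]
    against the normalized kernel, [1 - bump] contributes the relative loss of
    mass from the power [n] to the power [n.+1], which is 1 / (2 n + 2). *)
Lemma trig_poly_approximation g (L eps : R) : periodic g 1 ->
  (forall x y, `|g x - g y| <= L * `|x - y|) -> continuous g -> 0 < eps ->
  exists2 p, trig_poly p & forall x, `|p x - g x| <= eps.
Proof.
move=> per gL cg e0; have e20 : 0 < eps / 2 by rewrite divr_gt0.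
have [K K0 gK] := lipschitz_bump_modulus per gL e20.
pose n := Num.truncn (K / eps).
have Kn : K / (2 * n.+1)%:R <= eps / 2.
  rewrite ler_pdivrMr ?ltr0n ?muln_gt0// natrM mulrA divfK ?pnatr_eq0//.
  by rewrite mulrC -ler_pdivrMr// ltW// truncnS_gt.
pose I := bump_mass n 0.
have I0 : 0 < I by exact: bump_mass_gt0.
exists (fun x => I^-1 * \int[torus_measure R]_y (g y * bump (x - y) ^+ n)).
  by apply: trig_mul (trig_cst _) _; exact: bump_convolution_trig.
move=> x.
have cb m : continuous (fun y => bump (x - y) ^+ m) by exact: bumpX_continuous.
have cgb : continuous (fun y => g y * bump (x - y) ^+ n) by exact: continuous_mul.
have cxb : continuous (fun y => g x * bump (x - y) ^+ n).
  by apply: continuous_mul => //; exact: continuous_const.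
have -> : I^-1 * \int[torus_measure R]_y (g y * bump (x - y) ^+ n) - g x =
    I^-1 * \int[torus_measure R]_y
      (g y * bump (x - y) ^+ n - g x * bump (x - y) ^+ n).
  rewrite torus_integralB// mulrBr torus_integralZ// -/(bump_mass n x).
  by rewrite bump_mass_cst -/I mulrCA mulVf ?mulr1// gt_eqF.
rewrite normrM gtr0_norm ?invr_gt0// ler_pdivrMl//.
apply: le_trans (torus_integral_abs _) _; first exact: continuous_sub.
have E : \int[torus_measure R]_y ((eps / 2 + K) * bump (x - y) ^+ n -
     K * bump (x - y) ^+ n.+1) = (eps / 2 + K) * I - K * bump_mass n.+1 0.
  rewrite torus_integralB; try by apply: continuous_mul => //; exact: continuous_const.
  by rewrite !torus_integralZ// -/(bump_mass n x) -/(bump_mass n.+1 x)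
    !(bump_mass_cst _ x).
apply: (@le_trans _ _ ((eps / 2 + K) * I - K * bump_mass n.+1 0)).
  rewrite -E; apply: torus_integral_le.
  - exact/continuous_norm/continuous_sub.
  - by apply: continuous_sub; apply: continuous_mul => //; exact: continuous_const.
  move=> y; rewrite -mulrBl normrM [X in _ * X]ger0_norm ?exprn_ge0 ?bump_ge0//.
  rewrite exprS mulrA -mulrBl ler_wpM2r ?exprn_ge0 ?bump_ge0//.
  rewrite distrC; apply: le_trans (gK x y) _.
  by rewrite mulrBr mulr1 addrA.
have -> : bump_mass n.+1 0 = I - I / (2 * n.+1)%:R.
  apply: (@mulfI _ (2 * n.+1)%:R); first by rewrite pnatr_eq0 muln_eq0.
  rewrite bump_massS -/I mulrBr [X in _ = _ - X]mulrC divfK ?pnatr_eq0 ?muln_eq0//.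
  by rewrite mulnS -[in RHS]natr1 -addn1 natrD; ring.
have -> : (eps / 2 + K) * I - K * (I - I / (2 * n.+1)%:R) =
  I * (eps / 2 + K / (2 * n.+1)%:R) by ring.
by rewrite ler_pM2l// [leRHS]splitr lerD2l.
Qed.

End TrigonometricApproximation.

(** * Lebesgue norms on the torus *)

Section TorusLnorm.
Variable R : realType.
Implicit Types (f g w : R -> R).

Lemma EFin_torus_integral f : continuous f ->
  (\int[torus_measure R]_x (f x)%:E)%E = (\int[torus_measure R]_x f x)%:E.
Proof.
move=> cf; rewrite /Rintegral fineK//.
by apply: integrable_fin_num => //; exact: torus_integrable.
Qed.

Lemma torus_Lnorm1 f : continuous f ->
  torus_Lnorm 1 f = (\int[torus_measure R]_x `|f x|)%:E.
Proof.
move=> cf; rewrite /torus_Lnorm Lnorm1 -EFin_torus_integral//.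
exact: continuous_norm.
Qed.

Lemma torus_Lnorm_le f g (p : R) : 0 < p -> continuous f -> continuous g ->
  (forall x, `|f x| `^ p <= g x) ->
  (torus_Lnorm p%:E f <= ((\int[torus_measure R]_x g x) `^ p^-1)%R%:E)%E.
Proof.
move=> p0 cf cg fg; rewrite /torus_Lnorm unlock -poweR_EFin.
have g0 x : 0 <= g x by apply: le_trans (fg x); exact: powR_ge0.
have i0 : (0 <= \int[torus_measure R]_x (`|(EFin \o f) x| `^ p))%E.
  by apply: integral_ge0 => x _; exact: poweR_ge0.
apply: gt0_ler_poweR; rewrite ?invr_ge0 ?(ltW p0)//.
- by rewrite in_itv/= i0 leey.
- by rewrite in_itv/= lee_fin torus_integral_ge0// leey.
rewrite -EFin_torus_integral//; apply: ge0_le_integral => //.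
- by move=> x _; rewrite lee_fin powR_ge0.
- apply/measurable_EFinP; apply: (measurableT_comp (measurable_powR p)).
  by apply: continuous_measurable; exact: continuous_norm.
- by apply/measurable_EFinP; exact: continuous_measurable.
- by move=> x _; rewrite lee_fin; exact: fg.
Qed.

Lemma torus_Lnormy_le f (B : R) : (forall x, `|f x| <= B) ->
  (torus_Lnorm +oo f <= B%:E)%E.
Proof.
move=> fB; rewrite /torus_Lnorm unlock torus_measureT lte01.
by apply/ess_supP/nearW => x /=; rewrite lee_fin.
Qed.

Lemma torus_Lnorm_le_bound f (B : R) (p : \bar R) : continuous f ->
  (0 < p)%E -> (forall x, `|f x| <= B) -> (torus_Lnorm p f <= B%:E)%E.
Proof.
move=> cf; case: p => [p| |//]; last by move=> _; exact: torus_Lnormy_le.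
rewrite lte_fin => p0 fB; have B0 : 0 <= B by apply: le_trans (fB 0).
have := @torus_Lnorm_le f (fun=> B `^ p) p p0 cf (@continuous_const _ _).
rewrite torus_integral_cst -powRrM mulfV ?gt_eqF// powRr1//; apply => x.
by rewrite ge0_ler_powR ?nnegrE ?(ltW p0).
Qed.

Lemma hoelder_conjugate_real (p : R) : 1 < p ->
  hoelder_conjugate p%:E = (p / (p - 1))%:E.
Proof.
move=> p1; rewrite /hoelder_conjugate/= eqe gt_eqF ?(lt_trans ltr01)// -EFinB.
by rewrite inver subr_eq0 gt_eqF.
Qed.

(** Let G be the integral of |w|. As |w| <= 1, the integral of |w|^(s') is at
    most G, and the L^(s')-norm of [w] at most G^(1/s') = G^(1 - 1/s). For
    [s = 1] the exponent of the normalization is 0. *)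
Lemma torus_Lnorm_normalized (s : R) w : 1 <= s -> continuous w ->
  (forall x, `|w x| <= 1) -> 0 < \int[torus_measure R]_x `|w x| ->
  (torus_Lnorm (hoelder_conjugate s%:E)
    (fun x => (\int[torus_measure R]_y `|w y|) `^ (s^-1 - 1) * w x)%R <= 1)%E.
Proof.
move=> + cw w1; set G := Rintegral _ _ _ => + G0.
rewrite le_eqVlt => /predU1P[<-|s1].
  rewrite hoelder_conjugate1 invr1 subrr powRr0.
  by apply: torus_Lnormy_le => x; rewrite mul1r.
rewrite hoelder_conjugate_real//; set p := s / (s - 1).
have s0 : 0 < s by exact: lt_trans s1.
have sN0 : s != 0 by rewrite gt_eqF.
have s10 : s - 1 != 0 by rewrite gt_eqF// subr_gt0.
have p1 : 1 <= p by rewrite ler_pdivlMr ?subr_gt0// mul1r gerBl.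
have p0 : 0 < p by exact: lt_le_trans p1.
have cG : continuous (fun x => G^-1 * `|w x|).
  by apply: continuous_mul; [exact: continuous_const|exact: continuous_norm].
have := @torus_Lnorm_le (fun x => G `^ (s^-1 - 1) * w x) _ p p0 _ cG.
rewrite torus_integralZ; last exact: continuous_norm.
rewrite -/G mulVf ?gt_eqF// powR1; apply.
  by apply: continuous_mul => //; exact: continuous_const.
move=> x; rewrite normrM ger0_norm ?powR_ge0// powRM ?powR_ge0// -powRrM.
rewrite (_ : (s^-1 - 1) * p = -1); last by rewrite /p; field; rewrite s10.
rewrite powR_inv1 ?(ltW G0)// ler_wpM2l ?invr_ge0 ?(ltW G0)//.
have [->|wx] := eqVneq (w x) 0; first by rewrite normr0 powR0// gt_eqF.
by apply: ge1r_powR => //; rewrite normr_gt0 wx w1.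
Qed.

Lemma hoelder_conjugate_fine_ge1 (r : \bar R) : (1 < r)%E ->
  1 <= fine (hoelder_conjugate r).
Proof.
case: r => [r| |//]; last by rewrite hoelder_conjugatey.
rewrite lte_fin => r1; rewrite hoelder_conjugate_real//=.
by rewrite ler_pdivlMr ?subr_gt0// mul1r gerBl.
Qed.

(** As |w| <= 1, the integral of |w| bounds that of |w|^(r'), the factor
    that appears in the inequality of Hoelder. *)
Lemma torus_hoelder (r : \bar R) f w : (1 < r)%E -> continuous f ->
  continuous w -> (forall x, `|w x| <= 1) ->
  ((\int[torus_measure R]_x `|f x * w x|)%R%:E <= torus_Lnorm r f *
   ((\int[torus_measure R]_x `|w x|) `^ (fine (hoelder_conjugate r))^-1)%R%:E)%E.
Proof.
move=> r1 cf cw w1; have cfw := continuous_mul cf cw.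
have cnw := continuous_norm cw.
case: r r1 => [r| |//]; last first.
  move=> _; rewrite hoelder_conjugatey/= invr1 powRr1; last first.
    exact: torus_integral_ge0.
  set A := torus_Lnorm _ _.
  rewrite -!EFin_torus_integral//; last exact: continuous_norm.
  rewrite -ge0_integralZl//; last 2 first.
  - by apply/measurable_EFinP; exact: continuous_measurable.
  - by rewrite /A/torus_Lnorm Lnorm_ge0.
  apply: ae_ge0_le_integral => //.
  - by apply/measurable_EFinP; apply: continuous_measurable; exact: continuous_norm.
  - by move=> x _; rewrite mule_ge0// /A/torus_Lnorm Lnorm_ge0.
  - apply: measurable_funeM; by apply/measurable_EFinP; exact: continuous_measurable.
  have : (\forall x \ae torus_measure R, `|(f x)%:E| <= A)%E.
    rewrite /A /torus_Lnorm unlock torus_measureT lte01.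
    exact: (ess_sup_ge (torus_measure R) (abse \o (EFin \o f))).
  apply: filterS; first exact: (ae_filter_ringOfSetsType (torus_measure R)).
  move=> x fxA _.
  by rewrite normrM EFinM lee_wpmul2r.
rewrite lte_fin => r1; have r0 : 0 < r by exact: lt_trans r1.
rewrite hoelder_conjugate_real//=; set q := r / (r - 1).
have q1 : 1 <= q by rewrite ler_pdivlMr ?subr_gt0// mul1r gerBl.
have q0 : 0 < q by exact: lt_le_trans q1.
rewrite -torus_Lnorm1//.
have := @hoelder _ _ _ (torus_measure R) f w r q
  (continuous_measurable cf) (continuous_measurable cw) r0 q0.
move=> /(_ _)/le_trans; apply.
  have s10 : r - 1 != 0 by rewrite gt_eqF// subr_gt0.
  by rewrite /q; field; rewrite s10 gt_eqF.
rewrite lee_wpmul2l ?Lnorm_ge0//; apply: torus_Lnorm_le => // x.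
have [->|wx] := eqVneq (w x) 0; first by rewrite normr0 powR0// gt_eqF.
by apply: ge1r_powR => //; rewrite normr_gt0 wx w1.
Qed.

End TorusLnorm.

(** * Periodic functions, and a truncated sign function *)

Section PeriodicFunctions.
Variable R : realType.
Implicit Types (f F : R -> R).

Lemma periodic_shift f (a x : R) : periodic f 1 ->
  exists y, [/\ a <= y, y < a + 1 & f y = f x].
Proof.
move=> per; exists (x + (- Num.floor (x - a))%:~R).
rewrite periodic_int// mulrNz.
by have /andP[] := floor_itv (x - a); rewrite intrD => u v; split => //; lra.
Qed.

Lemma periodic_continuous_bounded f : periodic f 1 -> continuous f ->
  exists2 B, 0 < B & forall x, `|f x| <= B.
Proof.
move=> per cf.
have [|c _ fc] := @EVT_max R (fun x => `|f x|) 0 1 ler01.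
  exact/continuous_subspaceT/continuous_norm.
exists (`|f c| + 1); first by rewrite ltr_wpDl.
move=> x; have [y [y0 y1 <-]] := periodic_shift 0 x per.
by rewrite ler_wpDr// fc// in_itv/= y0 ltW// -[1]add0r.
Qed.

Lemma periodic_primitive f F : periodic f 1 ->
  (forall x : R, is_derive x (1 : R) F (f x)) -> F 1 = F 0 -> periodic F 1.
Proof.
move=> per dF F10 x.
have d (y : R) : is_derive y (1 : R) (fun y => F (y + 1) - F y) 0.
  have d1 : is_derive y (1 : R) (fun y : R => y + 1) 1.
    have := is_deriveD (is_derive_id y (1 : R)) (is_derive_cst (1 : R) y (1 : R)).
    by move/is_derive_eq; apply; rewrite addr0.
  have := is_deriveB
    (@is_derive1_comp _ F (fun y : R => y + 1) y _ _ (dF (y + 1)) d1) (dF y).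
  by move/is_derive_eq; apply; rewrite mulr1 per subrr.
have := @is_derive_0_is_cst _ (fun y => F (y + 1) - F y) x 0 d.
by rewrite add0r F10 subrr => /eqP; rewrite subr_eq0 => /eqP.
Qed.

(** A primitive of [f] is both nondecreasing and periodic, hence constant. *)
Lemma torus_integral_eq0 f : periodic f 1 -> continuous f ->
  (forall x, 0 <= f x) -> \int[torus_measure R]_x f x = 0 -> f = cst 0.
Proof.
move=> per cf f0; have [F dF F0] := continuous_primitive cf.
rewrite (torus_FTC cf dF) F0 subr0 => F1.
have perF : periodic F 1 by apply: periodic_primitive dF _; rewrite ?F1 ?F0.
have mono x y : x <= y -> F x <= F y by move=> xy; apply: derive_ge0_le dF xy _.
have le x y : F x <= F y.
  have [z [_ zy <-]] := periodic_shift (y - 1) x perF.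
  by apply: mono; rewrite subrK in zy; exact: ltW.
have E : F = cst 0.
  by apply/funext => x /=; apply/eqP; rewrite -F0 eq_le !le.
apply/funext => x; have [_ <-] := dF x; rewrite E.
exact: derive_cst.
Qed.

Lemma derive_bounded_lipschitz f F (B : R) :
  (forall x : R, is_derive x (1 : R) F (f x)) -> (forall x, `|f x| <= B) ->
  forall x y, `|F x - F y| <= B * `|x - y|.
Proof.
move=> dF fB x y; wlog yx : x y / y <= x.
  move=> H; have [/H//|/ltW/H] := leP y x.
  by rewrite distrC [`|y - x|]distrC.
have [c _ ->] := @MVT_segment _ F f y x yx (fun z _ => dF z)
  (continuous_subspaceT (is_derive_continuous dF)).
by rewrite normrM ler_wpM2r.
Qed.

Lemma lipschitz_continuous f (L : R) :
  (forall x y, `|f x - f y| <= L * `|x - y|) -> continuous f.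
Proof.
move=> fL x; apply/cvgrPdist_le => e e0.
have L0 : 0 <= L.
  by have := fL 1 0; rewrite subr0 normr1 mulr1; apply: le_trans.
near=> y.
apply: le_trans (fL x y) _.
have xy : `|x - y| <= e / (L + 1).
  by near: y; apply: cvgr_dist_le => //; rewrite divr_gt0// ltr_wpDl.
apply: (@le_trans _ _ ((L + 1) * `|x - y|)); first by rewrite ler_wpM2r// lerDl.
by rewrite mulrC -ler_pdivlMr// ltr_wpDl.
Unshelve. all: end_near. Qed.

End PeriodicFunctions.

Section DeadZone.
Variable R : realType.

Definition clamp (a y : R) : R := Num.max (- a) (Num.min a y).

Lemma clamp_lipschitz a x y : `|clamp a x - clamp a y| <= `|x - y|.
Proof.
wlog xy : x y / x <= y.
  move=> H; have [/H//|/ltW/H] := leP x y.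
  by rewrite distrC [`|y - x|]distrC.
rewrite [X in _ <= X]distrC [X in X <= _]distrC [X in _ <= X]ger0_norm ?subr_ge0//.
rewrite ler_norml /clamp !maxEle !minEle.
by case: (leP a y) => ?; case: (leP a x) => ?; case: (leP (- a) a) => ?;
  case: (leP (- a) x) => ?; case: (leP (- a) y) => ?; lra.
Qed.

(** A Lipschitz substitute for the sign of [y] cut off to 1 <= |y|: it vanishes
    for |y| <= 1 and is the sign of [y] for 2 <= |y|. *)
Definition deadzone (y : R) : R := clamp 2 y - clamp 1 y.

Lemma deadzone_lipschitz x y : `|deadzone x - deadzone y| <= 2 * `|x - y|.
Proof.
rewrite /deadzone opprB addrACA [X in X <= _](_ : _ =
  `|(clamp 2 x - clamp 2 y) - (clamp 1 x - clamp 1 y)|); last by congr `|_|; ring.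
apply: le_trans (ler_normB _ _) _.
by rewrite mulr_natl mulr2n lerD// clamp_lipschitz.
Qed.

Variant deadzone_spec (y : R) : R -> Type :=
| DeadzoneLow of y <= -2 : deadzone_spec y (-1)
| DeadzoneMidLow of -2 <= y <= -1 : deadzone_spec y (y + 1)
| DeadzoneZero of -1 <= y <= 1 : deadzone_spec y 0
| DeadzoneMidHigh of 1 <= y <= 2 : deadzone_spec y (y - 1)
| DeadzoneHigh of 2 <= y : deadzone_spec y 1.

Lemma deadzoneP y : deadzone_spec y (deadzone y).
Proof.
rewrite /deadzone /clamp.
have [y2|] := boolP (y <= -2).
  rewrite [Num.min 2 y]min_r ?[Num.min 1 y]min_r ?max_l; try lra.
  by rewrite (_ : - 2 - - 1 = -1); [constructor|ring].
rewrite -ltNge => y2; have [y1|] := boolP (y <= -1).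
  rewrite [Num.min 2 y]min_r ?[Num.min 1 y]min_r ?[Num.max (- 1) _]max_l
    ?[Num.max (- 2) _]max_r; try lra.
  by rewrite opprK; constructor; lra.
rewrite -ltNge => y1; have [y0|] := boolP (y <= 1).
  rewrite [Num.min 2 y]min_r ?[Num.min 1 y]min_r ?[Num.max (- 1) _]max_r
    ?[Num.max (- 2) _]max_r; try lra.
  by rewrite subrr; constructor; lra.
rewrite -ltNge => y0; have [y3|] := boolP (y <= 2).
  rewrite [Num.min 2 y]min_r ?[Num.min 1 y]min_l ?[Num.max (- 1) _]max_r
    ?[Num.max (- 2) _]max_r; try lra.
  by constructor; lra.
rewrite -ltNge => y3.
rewrite [Num.min 2 y]min_l ?[Num.min 1 y]min_l ?[Num.max (- 1) _]max_r
    ?[Num.max (- 2) _]max_r; try lra.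
by rewrite (_ : 2 - 1 = 1); [constructor; lra|ring].
Qed.

Lemma deadzone_norm_le1 y : `|deadzone y| <= 1.
Proof. by rewrite ler_norml; case: deadzoneP => ?; lra. Qed.

Lemma deadzone_ge0 y : 0 <= y -> 0 <= deadzone y.
Proof. by case: deadzoneP => ? ?; lra. Qed.

Lemma deadzone_le0 y : y <= 0 -> deadzone y <= 0.
Proof. by case: deadzoneP => ? ?; lra. Qed.

(** This is where the dead zone matters: [deadzone y] vanishes unless 1 <= |y|. *)
Lemma deadzone_pairing y : `|deadzone y| <= y * deadzone y.
Proof.
case: deadzoneP => y2; rewrite ?normr0 ?mulr0//.
- by rewrite normrN1; lra.
- by rewrite ler0_norm; [nra|lra].
- by rewrite ger0_norm; [nra|lra].
- by rewrite normr1; lra.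
Qed.

(** The left-hand side is at most 1 and vanishes for 2 <= |y|, where the
    right-hand side drops below 1. The right-hand side is the derivative of the
    bounded function 5 atan, which makes it easy to integrate along [Psi]. *)
Lemma deadzone_defect y : 1 - `|deadzone y| <= 5 * (1 + y ^+ 2)^-1.
Proof.
have p : 0 < 1 + y ^+ 2 by rewrite ltr_pwDl// sqr_ge0.
rewrite ler_pdivlMr// expr2.
case: deadzoneP => y2.
- by rewrite normrN1 subrr mul0r.
- by rewrite ler0_norm; [nra|lra].
- by rewrite normr0; nra.
- by rewrite ger0_norm; [nra|lra].
- by rewrite normr1 subrr mul0r.
Qed.

End DeadZone.

(** * Lower bound of the negative Sobolev norm by duality *)

Section Assembly.
Variable R : realType.
Implicit Types (phi Psi w p : R -> R).

(** The intermediate value theorem in [c]: the integral is nonnegative when [c]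
    lies below the range of [Psi], and nonpositive when [c] lies above it. *)
Lemma exists_balanced_level Psi (t B : R) : 0 < t -> continuous Psi ->
  (forall x, `|Psi x| <= B) ->
  exists c, \int[torus_measure R]_x deadzone ((Psi x - c) / t) = 0.
Proof.
move=> t0 cP PB; have B0 : 0 <= B by apply: le_trans (PB 0).
have cdz c : continuous (fun x => deadzone ((Psi x - c) / t)).
  move=> x; apply: (@continuous_comp _ _ _ (fun x => (Psi x - c) / t) (@deadzone R)).
    apply: continuous_mul; last exact: continuous_const.
    by apply: continuous_sub => //; exact: continuous_const.
  by apply: lipschitz_continuous; exact: deadzone_lipschitz.
pose m c := \int[torus_measure R]_x deadzone ((Psi x - c) / t).
have mL c c' : `|m c - m c'| <= (2 / t) * `|c - c'|.
  rewrite /m -torus_integralB//; apply: le_trans (torus_integral_abs _) _.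
    exact: continuous_sub.
  rewrite -[leRHS]torus_integral_cst; apply: torus_integral_le.
  - by apply: continuous_norm; exact: continuous_sub.
  - exact: continuous_const.
  move=> x; apply: le_trans (deadzone_lipschitz _ _) _.
  rewrite -mulrBl opprB addrC addrA subrK normrM [`|t^-1|]gtr0_norm ?invr_gt0//.
  by rewrite distrC -mulrA [_^-1 * _]mulrC.
have [|||c _ mc] := @IVT R m (- B) B 0; last by exists c.
- by rewrite ge0_cp.
- exact/continuous_subspaceT/(lipschitz_continuous mL).
have mN : 0 <= m (- B).
  apply: torus_integral_ge0 => x; apply: deadzone_ge0.
  by have := PB x; rewrite ler_norml => /andP[? _]; rewrite divr_ge0 ?(ltW t0)//; lra.
have mP : m B <= 0.
  rewrite -[leRHS](torus_integral_cst 0); apply: torus_integral_le => // [|x].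
    exact: continuous_const.
  apply: deadzone_le0.
  by have := PB x; rewrite ler_norml => /andP[_ ?]; rewrite pmulr_lle0 ?invr_gt0//; lra.
by rewrite ge_min mP orbT le_max mN.
Qed.

Lemma trig_poly_primitive p : trig_poly p ->
  \int[torus_measure R]_x p x = 0 ->
  exists2 u, torus_smooth u & forall x : R, is_derive x (1 : R) u (p x).
Proof.
move=> tp p0; have cp := trig_poly_continuous tp.
have [u du u0] := continuous_primitive cp.
exists u => //; split.
  apply: (periodic_primitive _ du); first exact: trig_poly_periodic.
  by apply/eqP; rewrite -subr_eq0 -(torus_FTC cp du) p0.
have Eu : derive1 u = p.
  by apply/funext => x; rewrite derive1E; apply: derive_val; exact: du.
case=> [|n] x; first exact: (@ex_derive _ _ _ _ _ _ _ (du x)).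
rewrite derive1Sn Eu.
have [q _ dq] := trig_poly_derive (trig_poly_derive1n n tp).
exact: (@ex_derive _ _ _ _ _ _ _ (dq x)).
Qed.

Lemma torus_integration_by_parts phi Psi u p :
  continuous phi -> continuous p ->
  (forall x : R, is_derive x (1 : R) Psi (phi x)) ->
  (forall x : R, is_derive x (1 : R) u (p x)) ->
  Psi 1 = Psi 0 -> u 1 = u 0 ->
  \int[torus_measure R]_x (phi x * u x) =
  - \int[torus_measure R]_x (Psi x * p x).
Proof.
move=> cphi cp dPsi du Psi1 u1.
have cPsi := is_derive_continuous dPsi; have cu := is_derive_continuous du.
have dPu (x : R) : is_derive x (1 : R) (fun x => Psi x * u x)
    (Psi x * p x + phi x * u x).
  have := is_deriveM (dPsi x) (du x).
  by move/is_derive_eq; apply; rewrite /GRing.scale/= [u x * _]mulrC.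
have := torus_FTC (continuous_add (continuous_mul cPsi cp) (continuous_mul cphi cu)) dPu.
rewrite torus_integralD; [|exact: continuous_mul|exact: continuous_mul].
by rewrite Psi1 u1 subrr => /eqP; rewrite addrC addr_eq0 => /eqP.
Qed.

(** With [w] itself as the derivative of a test function the bound would hold
    without the factor 1 / 4. But [w] is not smooth: it is replaced by a
    trigonometric polynomial [2 q] with mean zero. Passing to [q] keeps the
    values in [-1, 1] and costs a factor 2, and the error of approximation
    another one. *)
Lemma negative_sobolev_norm_ge (s L : R) phi Psi w : 1 <= s ->
  continuous phi -> (forall x : R, is_derive x (1 : R) Psi (phi x)) ->
  Psi 1 = Psi 0 -> (exists B, forall x, `|Psi x| <= B) ->
  periodic w 1 -> (forall x y, `|w x - w y| <= L * `|x - y|) ->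
  (forall x, `|w x| <= 1) ->
  \int[torus_measure R]_x w x = 0 ->
  0 < \int[torus_measure R]_x (Psi x * w x) ->
  (((\int[torus_measure R]_x `|w x|) `^ (s^-1 - 1)
    * (\int[torus_measure R]_x (Psi x * w x) / 4))%:E
   <= negative_sobolev_norm s phi)%E.
Proof.
move=> s1 cphi dPsi Psi1 [B PB] perw wL w1 w0 P0.
have cPsi := is_derive_continuous dPsi; have cw := lipschitz_continuous wL.
have cnw := continuous_norm cw.
have B0 : 0 <= B by apply: le_trans (PB 0).
set G := Rintegral _ _ _; set P := \int[torus_measure R]_x (Psi x * w x) in P0 *.
have PG : P <= B * G.
  apply: le_trans (ler_norm _) _; rewrite /G -torus_integralZ//.
  apply: le_trans (torus_integral_abs (continuous_mul cPsi cw)) _.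
  apply: torus_integral_le => [||x].
  - by apply: continuous_norm; exact: continuous_mul.
  - by apply: continuous_mul => //; exact: continuous_const.
  - by rewrite normrM ler_wpM2r.
have G0 : 0 < G.
  rewrite lt_neqAle torus_integral_ge0// andbT.
  by apply: contraTneq PG => <-; rewrite mulr0 -ltNge.
(* the error of approximation: at most 1 to keep |q| <= 1, at most G to keep
   the integral of |q| below G, and costing at most half of the pairing *)
pose d := Num.min (Num.min 1 G) (P / (2 * (B + 1))).
have B1 : 0 < B + 1 by rewrite ltr_wpDl.
have d0 : 0 < d by rewrite !lt_min ltr01 G0 divr_gt0// mulr_gt0.
have d1 : d <= 1 by rewrite !ge_min lexx.
have dG : d <= G by rewrite !ge_min lexx !orbT.
have dP : B * d <= P / 2.
  apply: (@le_trans _ _ ((B + 1) * (P / (2 * (B + 1))))).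
    by apply: ler_pM => //; rewrite ?(ltW d0)// ?lerDl// ge_min lexx orbT.
  by rewrite le_eqVlt; apply/orP; left; apply/eqP; field; rewrite gt_eqF.
have [p0 tp0 p0w] := trig_poly_approximation perw wL cw (divr_gt0 d0 (ltr0n R 2)).
have cp0 := trig_poly_continuous tp0.
pose pm := \int[torus_measure R]_x p0 x.
have pmd : `|pm| <= d / 2.
  rewrite /pm -[X in `|X|]subr0 -w0 -torus_integralB//.
  apply: le_trans (torus_integral_abs (continuous_sub cp0 cw)) _.
  rewrite -[leRHS]torus_integral_cst; apply: torus_integral_le => //.
  - by apply: continuous_norm; exact: continuous_sub.
  - exact: continuous_const.
pose q x := 2^-1 * (p0 x + - pm).
have tq : trig_poly q.
  exact: trig_mul (trig_cst _) (trig_add tp0 (trig_cst _)).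
have cq := trig_poly_continuous tq; have cnq := continuous_norm cq.
have qw x : `|2 * q x - w x| <= d.
  rewrite /q mulrA mulfV// mul1r addrAC [leRHS]splitr.
  by apply: le_trans (ler_normB _ _) _; exact: lerD.
have q1 x : `|q x| <= 1.
  have := qw x; have := w1 x; have := d1; rewrite !ler_norml; lra.
have q_int : \int[torus_measure R]_x q x = 0.
  rewrite /q torus_integralZ; last by apply: continuous_sub => //; exact: continuous_const.
  rewrite torus_integralB//; last exact: continuous_const.
  by rewrite torus_integral_cst subrr mulr0.
pose Q := \int[torus_measure R]_x `|q x|.
have QG : Q <= G.
  apply: (@le_trans _ _ (2^-1 * (G + d))); last by move: dG; lra.
  rewrite /Q /G -(torus_integral_cst d) -torus_integralD//; last exact: continuous_const.
  have cwd : continuous (fun x => `|w x| + d).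
    by apply: continuous_add => //; exact: continuous_const.
  rewrite -torus_integralZ//; apply: torus_integral_le => //.
    by apply: continuous_mul => //; exact: continuous_const.
  move=> x.
  have : `|2 * q x| <= `|w x| + `|2 * q x - w x|.
    by rewrite -{1}(subrK (w x) (2 * q x)) addrC; exact: ler_normD.
  by rewrite normrM [`|2|]ger0_norm//; have := qw x; lra.
pose D := \int[torus_measure R]_x (Psi x * q x).
have DP : P / 4 <= D.
  suff : P - B * d <= 2 * D by move: dP; lra.
  rewrite /P /D -(torus_integral_cst (B * d)) -torus_integralB//; last 2 first.
  - exact: continuous_mul.
  - exact: continuous_const.
  rewrite -torus_integralZ; last exact: continuous_mul.
  apply: torus_integral_le => [||x].
  - apply: continuous_sub; last exact: continuous_const.
    exact: continuous_mul.
  - by apply: continuous_mul; [exact: continuous_const|exact: continuous_mul].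
  have : `|Psi x * (2 * q x - w x)| <= B * d.
    by rewrite normrM ler_pM.
  by rewrite ler_norml mulrBr => /andP[]; lra.
have D0 : 0 < D by apply: lt_le_trans DP; rewrite divr_gt0.
have Q0 : 0 < Q.
  rewrite lt_neqAle torus_integral_ge0// andbT.
  suff : D <= B * Q.
    by move=> DQ; apply: contraTneq DQ => <-; rewrite mulr0 -ltNge.
  apply: le_trans (ler_norm _) _; rewrite /Q -torus_integralZ//.
  apply: le_trans (torus_integral_abs (continuous_mul cPsi cq)) _.
  apply: torus_integral_le => [||x].
  - by apply: continuous_norm; exact: continuous_mul.
  - by apply: continuous_mul => //; exact: continuous_const.
  - by rewrite normrM ler_wpM2r.
have [u su du] : exists2 u, torus_smooth u &
    forall x : R, is_derive x (1 : R) u (Q `^ (s^-1 - 1) * q x).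
  apply: trig_poly_primitive; first exact: trig_mul (trig_cst _) tq.
  by rewrite torus_integralZ// q_int mulr0.
have Eu : derive1 u = (fun x => Q `^ (s^-1 - 1) * q x).
  by apply/funext => x; rewrite derive1E; apply: derive_val; exact: du.
apply: (@le_trans _ _ (`|\int[torus_measure R]_x (phi x * u x)|)%:E); last first.
  apply: ereal_sup_ubound; exists u => //; split => //.
  by rewrite Eu; exact: torus_Lnorm_normalized.
have cQq : continuous (fun x => Q `^ (s^-1 - 1) * q x).
  by apply: continuous_mul => //; exact: continuous_const.
rewrite (torus_integration_by_parts cphi cQq dPsi du Psi1); last first.
  by have [per _] := su; rewrite -[in LHS](add0r 1) per.
rewrite normrN lee_fin; apply: le_trans (ler_norm _).
have -> : \int[torus_measure R]_x (Psi x * (Q `^ (s^-1 - 1) * q x)) =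
    Q `^ (s^-1 - 1) * D.
  rewrite /D -torus_integralZ; last exact: continuous_mul.
  by apply: eq_torus_integral => x; rewrite mulrCA.
apply: ler_pM => //; rewrite ?powR_ge0 ?divr_ge0 ?(ltW P0)//.
(* the exponent is nonpositive, so that Q <= G gives the right inequality *)
have -> : s^-1 - 1 = - (1 - s^-1) by rewrite opprB.
rewrite !powRN lef_pV2 ?posrE ?powR_gt0//.
apply: ge0_ler_powR; rewrite ?nnegrE ?(ltW G0) ?(ltW Q0)//.
by rewrite subr_ge0 invf_le1 ?(lt_le_trans ltr01).
Qed.

End Assembly.

(** * The lower bound *)

Section SignChanges.
Variable R : realType.
Implicit Types (phi Psi w : R -> R).

(** A continuous function of constant sign and mean zero vanishes. *)
Lemma mean_zero_signs phi : periodic phi 1 -> continuous phi ->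
  phi <> cst 0 -> \int[torus_measure R]_x phi x = 0 ->
  (2%:E <= sign_changes phi)%E.
Proof.
move=> per cphi phi0 int0.
have neg : exists2 x, 0 <= x <= 1 & phi x < 0.
  apply: contrapT => H; apply: phi0; apply: torus_integral_eq0 => // x.
  have [y [y0 /ltW]] := periodic_shift 0 x per; rewrite add0r => y1 <-.
  by rewrite leNgt; apply/negP => py; apply: H; exists y; rewrite ?y0.
have pos : exists2 x, 0 <= x <= 1 & 0 < phi x.
  apply: contrapT => H; apply: phi0.
  have : (fun x => - phi x) = cst 0.
    apply: torus_integral_eq0 => [x|x|x|]; first by rewrite per.
    - by apply: cvgN; exact: cphi.
    - have [y [y0 /ltW]] := periodic_shift 0 x per; rewrite add0r => y1 <-.
      by rewrite oppr_ge0 leNgt; apply/negP => py; apply: H; exists y; rewrite ?y0.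
    - rewrite (eq_torus_integral (g := fun x => -1 * phi x)) => [|x];
        last by rewrite mulN1r.
      by rewrite torus_integralZ// int0 mulr0.
  move=> /(congr1 (fun f : R -> R => fun x => - f x)) E; apply/funext => x.
  by have := congr1 (@^~ x) E; rewrite /= opprK oppr0.
have [x x01 px] := neg; have [y y01 py] := pos.
by apply: (sign_changes_ge2 per x01 y01); rewrite nmulr_rlt0.
Qed.

(** The last term bounds the mass that |phi| carries near the level 0 of [Psi].
    Indeed [1 - |deadzone (Psi x / t)|] is at most [weight], and
    [phi x * weight x] is the derivative of [5 t atan (Psi / t)], a function with
    oscillation at most [5 pi t]. Its total variation over a period is then at
    most [N + 1 <= 2 N] times as much. *)
Lemma concentration_near_level phi Psi (t N : R) : 0 < t -> 2 <= N ->
  sign_changes phi = N%:E -> continuous phi ->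
  (forall x : R, is_derive x (1 : R) Psi (phi x)) ->
  \int[torus_measure R]_x `|phi x| <=
  \int[torus_measure R]_x `|phi x * deadzone (Psi x / t)| + 10 * pi * N * t.
Proof.
move=> t0 N2 EN cphi dPsi.
have cPsi := is_derive_continuous dPsi.
have tN0 : t != 0 by rewrite gt_eqF.
pose weight x := 5 * (1 + (Psi x / t) ^+ 2)^-1.
pose F x := 5 * t * atan (Psi x / t).
have cPt : continuous (fun x => Psi x / t).
  by apply: continuous_mul => //; exact: continuous_const.
have dF (x : R) : is_derive x (1 : R) F (phi x * weight x).
  have dPt : is_derive x (1 : R) (fun x => Psi x / t) (phi x / t).
    have := is_deriveZ t^-1 (dPsi x); rewrite (_ : _ \*: _ = (fun x => Psi x / t)).
      by move/is_derive_eq; apply; rewrite /GRing.scale/= mulrC.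
    by apply/funext => z; rewrite [RHS]mulrC.
  have := is_deriveZ (5 * t)
    (@is_derive1_comp _ (@atan R) _ x _ _ (is_derive1_atan _) dPt).
  move/is_derive_eq; apply; rewrite /weight /GRing.scale/=.
  by set z := (1 + _)^-1; field.
have Fk x y : F x - F y <= 5 * pi * t.
  rewrite /F -mulrBr.
  have := atan_ltpi2 (Psi x / t); have := atan_gtNpi2 (Psi y / t).
  set a := atan _; set b := atan _ => a1 b1.
  have -> : 5 * pi * t = 5 * t * pi by ring.
  by rewrite ler_pM2l ?mulr_gt0//; lra.
have csq : continuous (fun x => 1 + Psi x / t * (Psi x / t)).
  by apply: continuous_add; [exact: continuous_const|exact: continuous_mul].
have cweight : continuous weight.
  apply: continuous_mul; first exact: continuous_const.
  move=> x; apply: cvgV; first by rewrite gt_eqF// ltr_pwDl// sqr_ge0.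
  exact: csq.
have cnphi := continuous_norm cphi.
have cnw := continuous_mul cnphi cweight.
have [V dV V0] := continuous_primitive cnw.
pose n := Num.truncn (N + 1).
have nN : n%:R <= N + 1 by rewrite /n truncn_le//; lra.
have varV : V 1 - V 0 <= n%:R * (5 * pi * t).
  apply: (variation_alternations dF dV Fk ler01) => s ss sin.
  rewrite /n truncn_ge_nat; last by lra.
  have := @chain_size_le _ phi 0 s ss; rewrite EN -EFinD lee_fin add0r; apply.
  by move=> x /sin /andP[].
have kt0 : 0 <= 5 * pi * t by rewrite !mulr_ge0 ?pi_ge0 ?(ltW t0).
have total : \int[torus_measure R]_x (`|phi x| * weight x) <= 10 * pi * N * t.
  rewrite (torus_FTC cnw dV); apply: le_trans varV _.
  rewrite (_ : 10 * pi * N * t = (2 * N) * (5 * pi * t)); last by ring.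
  by apply: ler_wpM2r => //; lra.
have cdz : continuous (fun x => deadzone (Psi x / t)).
  move=> x; apply: (@continuous_comp _ _ _ (fun x => Psi x / t) (@deadzone R)).
    exact: cPt.
  by apply: lipschitz_continuous; exact: deadzone_lipschitz.
have cpd := continuous_norm (continuous_mul cphi cdz).
apply: le_trans (lerD (lexx _) total).
rewrite -torus_integralD//; apply: torus_integral_le => // [|x].
  exact: continuous_add.
rewrite normrM -mulrDr ler_peMr//.
by have := deadzone_defect (Psi x / t); rewrite /weight; lra.
Qed.

End SignChanges.

(** The level [t] below is chosen to make the loss [10 pi N t] in
    [concentration_near_level] equal to half the mass of |phi|. This leaves
    M / 2 <= A G^(1/r'), whence a lower bound on G, the integral of |w|. *)
Lemma sign_changes_sobolev_bound (R : realType) (s N : R) (r : \bar R)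
    (phi : R -> R) :
  1 <= s -> (1 < r)%E -> torus_continuous phi -> phi <> cst 0 ->
  \int[torus_measure R]_x phi x = 0 -> sign_changes phi = N%:E ->
  exists2 A, torus_Lnorm r phi = A%:E & 0 < A /\
  let M := \int[torus_measure R]_x `|phi x| in
  let b := fine (hoelder_conjugate r) / s in
  0 < M /\ ((M / (80 * pi * N) * (M / (2 * A)) `^ b)%:E
            <= negative_sobolev_norm s phi)%E.
Proof.
move=> s1 r1 [per cphi] phi0 int0 EN.
have N2 : 2 <= N by rewrite -lee_fin -EN mean_zero_signs.
have N0 : 0 < N by lra.
have s0 : 0 < s by exact: lt_le_trans s1.
have cnphi := continuous_norm cphi.
set M := \int[torus_measure R]_x `|phi x|.
have M0 : 0 < M.
  rewrite lt_neqAle torus_integral_ge0// andbT eq_sym; apply/eqP => M0; apply: phi0.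
  have pern : periodic (fun x => `|phi x|) 1 by move=> x; rewrite per.
  have E := torus_integral_eq0 pern cnphi (fun x => normr_ge0 _) M0.
  by apply/funext => x; apply/eqP; rewrite -normr_eq0; have := congr1 (@^~ x) E => /= ->.
have [B B0 pB] := periodic_continuous_bounded per cphi.
have r0 : (0 < r)%E by exact: lt_trans r1.
have [A EA] : exists A, torus_Lnorm r phi = A%:E.
  exists (fine (torus_Lnorm r phi)); rewrite fineK// ge0_fin_numE ?Lnorm_ge0//.
  exact: le_lt_trans (torus_Lnorm_le_bound cphi r0 pB) (ltry _).
exists A => //.
have A0 : 0 <= A by rewrite -lee_fin -EA Lnorm_ge0.
pose t := M / (20 * pi * N).
have p0 : 0 < pi :> R := pi_gt0 R.
have t0 : 0 < t by rewrite divr_gt0// !mulr_gt0.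
have [Phi dPhi Phi0] := continuous_primitive cphi.
have Phi10 : Phi 1 = Phi 0 by apply/eqP; rewrite -subr_eq0 -(torus_FTC cphi dPhi) int0.
have perPhi := periodic_primitive per dPhi Phi10.
have cPhi := is_derive_continuous dPhi.
have [BP BP0 PB] := periodic_continuous_bounded perPhi cPhi.
have [c Ec] := exists_balanced_level t0 cPhi PB.
pose Psi x := Phi x - c.
have dPsi (x : R) : is_derive x (1 : R) Psi (phi x).
  have := is_deriveB (dPhi x) (is_derive_cst c x (1 : R)).
  by move/is_derive_eq; apply; rewrite subr0.
pose w x := deadzone (Psi x / t).
have perw : periodic w 1 by move=> x; rewrite /w /Psi perPhi.
have wL x y : `|w x - w y| <= (2 * B / t) * `|x - y|.
  apply: le_trans (deadzone_lipschitz _ _) _.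
  rewrite -mulrBl normrM [`|t^-1|]gtr0_norm ?invr_gt0//.
  have := derive_bounded_lipschitz dPsi pB x y => H.
  rewrite (_ : 2 * B / t * `|x - y| = 2 * (B * `|x - y| / t)); last by ring.
  by rewrite ler_pM2l// ler_pM2r ?invr_gt0.
have cw := lipschitz_continuous wL.
have cPsi := is_derive_continuous dPsi.
set G := \int[torus_measure R]_x `|w x|.
have w1 x : `|w x| <= 1 by exact: deadzone_norm_le1.
have Mw : M / 2 <= \int[torus_measure R]_x `|phi x * w x|.
  have MI : M <= \int[torus_measure R]_x `|phi x * w x| + 10 * pi * N * t.
    exact: concentration_near_level.
  have tM : 10 * pi * N * t = M / 2.
    by rewrite /t; move: (pi) p0 => P P0; field; rewrite !gt_eqF.
  by move: MI; rewrite tM; lra.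
have hoel := torus_hoelder r1 cphi cw w1.
rewrite EA -EFinM lee_fin -/G in hoel.
set r' := fine (hoelder_conjugate r) in hoel *.
have r'1 : 1 <= r' by exact: hoelder_conjugate_fine_ge1.
have r'0 : 0 < r' by exact: lt_le_trans r'1.
have {hoel}MAG : M / 2 <= A * G `^ r'^-1 by exact: le_trans Mw hoel.
have A_gt0 : 0 < A.
  rewrite lt_neqAle A0 andbT; apply: contraTneq MAG => <-.
  by rewrite mul0r -ltNge divr_gt0.
split => //; split => //.
have G0 : 0 < G.
  rewrite lt_neqAle torus_integral_ge0// andbT; apply: contraTneq MAG => <-.
  by rewrite powR0 ?invr_eq0 ?gt_eqF// mulr0 -ltNge divr_gt0.
have GM : (M / (2 * A)) `^ r' <= G.
  have -> : G = (G `^ r'^-1) `^ r'.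
    by rewrite -powRrM mulVf ?gt_eqF// powRr1// ltW.
  apply: ge0_ler_powR; rewrite ?nnegrE ?powR_ge0 ?(ltW r'0)//.
    by rewrite divr_ge0 ?(ltW M0)// mulr_ge0.
  by rewrite invfM mulrA ler_pdivrMr// [leRHS]mulrC.
have tG : t * G <= \int[torus_measure R]_x (Psi x * w x).
  rewrite /G -torus_integralZ; last exact: continuous_norm.
  apply: torus_integral_le => [||x].
  - by apply: continuous_mul; [exact: continuous_const|exact: continuous_norm].
  - exact: continuous_mul.
  - rewrite -(ler_pM2l (_ : 0 < t^-1)) ?invr_gt0// mulKf ?gt_eqF//.
    by rewrite mulrA [t^-1 * _]mulrC; exact: deadzone_pairing.
have W := @negative_sobolev_norm_ge _ s _ phi Psi w s1 cphi dPsi _ _ perw wL w1 Ec _.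
apply: le_trans (W _ _ _); last 3 first.
- by rewrite /Psi Phi10.
- exists (BP + `|c|) => x; apply: le_trans (ler_normB _ _) _.
  by rewrite lerD.
- by apply: lt_le_trans tG; exact: mulr_gt0.
rewrite -/G lee_fin.
apply: (@le_trans _ _ (t / 4 * G `^ s^-1)).
  rewrite (_ : M / (80 * pi * N) = t / 4); last first.
    by rewrite /t; move: (pi) p0 => P P0; field; rewrite !gt_eqF.
  have t40 : 0 < t / 4 by move: (t) t0 => u u0; lra.
  rewrite ler_pM2l// powRrM; apply: ge0_ler_powR => //.
  - by rewrite invr_ge0 ltW.
  - by rewrite nnegrE powR_ge0.
  - by rewrite nnegrE ltW.
have -> : G `^ s^-1 = G `^ (s^-1 - 1) * G.
  rewrite powRB ?(gt_eqF G0) ?implybT// powRr1 ?(ltW G0)//.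
  by rewrite divfK// gt_eqF.
rewrite mulrCA ler_wpM2l ?powR_ge0//.
by move: tG; lra.
Qed.

Theorem theorem2p7 (R : realType) (s : R) (r : \bar R)
    (hs : 1 <= s) (hr : (1 < r)%E) :
  exists C : R, 0 < C /\
    forall phi : R -> R,
      torus_continuous phi ->
      phi <> cst 0 ->
      \int[torus_measure R]_x phi x = 0 ->
      (sign_changes phi < +oo)%E ->
      (C%:E * (torus_Lnorm 1 phi `^ beta_c s r
               / torus_Lnorm r phi `^ (beta_c s r - 1))
       <= sign_changes phi * negative_sobolev_norm s phi)%E.
Proof.
pose b := fine (hoelder_conjugate r) / s.
have Eb : beta_c s r = 1 + b by [].
exists ((80 * pi)^-1 * 2 `^ (- b)).
have p0 : 0 < pi :> R := pi_gt0 R.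
split; first by rewrite mulr_gt0 ?powR_gt0// invr_gt0 mulr_gt0.
move=> phi cphi phi0 int0 Nfin.
have N2 := mean_zero_signs cphi.1 cphi.2 phi0 int0.
have [N EN] : exists N, sign_changes phi = N%:E.
  exists (fine (sign_changes phi)); rewrite fineK// ge0_fin_numE//.
  by apply: le_trans N2; rewrite lee_fin.
have N0 : 0 < N by rewrite EN lee_fin in N2; lra.
have [A EA [A0 [M0]]] := sign_changes_sobolev_bound hs hr cphi phi0 int0 EN.
rewrite torus_Lnorm1; last exact: cphi.2.
set M := Rintegral _ _ _ in M0 *; rewrite -/b => W.
rewrite EN EA !poweR_EFin Eb addrAC subrr add0r inver gt_eqF ?powR_gt0//.
rewrite -!EFinM.
apply: le_trans (lee_wpmul2l _ W); last by rewrite lee_fin ltW.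
rewrite -EFinM lee_fin le_eqVlt; apply/orP; left; apply/eqP.
have -> : (M / (2 * A)) `^ b = M `^ b * 2 `^ (- b) / A `^ b.
  rewrite powRM ?(ltW M0) ?invr_ge0 ?mulr_ge0 ?(ltW A0)//.
  rewrite -powR_inv1 ?mulr_ge0 ?(ltW A0)//.
  by rewrite -powRrM mulN1r powRM ?(ltW A0)// [A `^ _]powRN mulrA.
rewrite powRD ?powRr1 ?(ltW M0)//; last by rewrite (gt_eqF M0) implybT.
by move: (pi) p0 => P P0; field; rewrite !gt_eqF ?powR_gt0.
Qed.
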